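(* Let $\mathcal C=(F_v,F_e,\mathcal T)$ be a crystal framework in $\mathbb R^d$ and let $g$ be a semiseparable space group symmetry or a symmetry which acts on $F_v$. Also, let $\mathcal E\subseteq\mathbb R^{d^2}$ be a space of affine velocity matrices which commute with $T_g$. Then $$\operatorname{tr}(\pi_{\rm mech}^{\mathcal E}(g))-\operatorname{tr}(\pi_{\rm str}^{\mathcal E}(g))=\operatorname{tr}(\pi_v^{\mathcal E}(g))-\operatorname{tr}(\pi_e(g))-\operatorname{tr}(\pi_{\rm rig}^{\mathcal E}(g)).$$
   Context: A full rank translation group on $\mathbb R^d$ is a set $\mathcal T=\{T_k:k\in\mathbb Z^d\}$ of translations with $T_{k+l}=T_kT_l$ whose period vectors $a_i=T_{\gamma_i}0$ ($\gamma_1,\dots,\gamma_d$ the standard basis) are linearly independent. $Z$ is the invertible matrix with $Z\gamma_i=a_i$, so $T_kx=x+Zk$. A crystal framework $\mathcal C=(F_v,F_e,\mathcal T)$ in $\mathbb R^d$, with motif $\mathcal M=(F_v,F_e)$, is a countable bar-joint framework (framework points in $\mathbb R^d$ together with framework edges, which are line segments of positive length joining certain pairs of framework points) whose framework points are $p_{\kappa,k}=T_kp_{\kappa,0}$, $1\le\kappa\le t$, $k\in\mathbb Z^d$, such that $F_v=\{p_{\kappa,0}\}$, $F_e$ is a finite set of framework edges, the set of framework points is the disjoint union of the $T_k(F_v)$ and the set of framework edges is the disjoint union of the $T_k(F_e)$. The edge $T_ke$, $e\in F_e$, is labelled $(e,k)$. A motif edge is written $e=[p_{\kappa,l},p_{\tau,l'}]$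 with edge vector $v_e=p_{\kappa,l}-p_{\tau,l'}$ and exponent $\delta(e)=l'-l=(\delta_1,\dots,\delta_d)$. The matrix $R(\mathcal M,\mathbb R^{d^2})$ is the $|F_e|\times(d|F_v|+d^2)$ matrix whose row for $e$ has $v_e$ in the $d$ columns for $\kappa$, $-v_e$ in the $d$ columns for $\tau$ (zero in these columns if $\kappa=\tau$), zeros in the other vertex columns, and $(\delta_1v_e,\dots,\delta_dv_e)$ in the last $d^2$ columns. An affine velocity matrix is a real $d\times d$ matrix, also viewed as a vector in $\mathbb R^{d^2}$ by writing its columns in order. For a linear space $\mathcal E$ of affine velocity matrices, $R(\mathcal M,\mathcal E):\mathbb R^{d|F_v|}\oplus\mathcal E\to\mathbb R^{|F_e|}$ is the restriction of $R(\mathcal M,\mathbb R^{d^2})$, where vector-matrix data $(u,A)$ is identified with the vector $(u,AZ)$, $AZ$ being written as its $d$ columns in order. The space group $\mathcal G(\mathcal C)$ is the group of isometries of $\mathbb R^d$ mapping $\mathcal C$ to itself, viewed as an abstract group; $T_g$ is the (possibly affine) isometry of $\mathbb R^d$ corresponding to $g$. It acts on vertex labels by $p_{g\cdot(\kappa,k)}=T_g(p_{\kappa,k})$, and correspondingly on edge labels, $(e,k)\mapsto g\cdot(e,k)$. An element $g$ is semiseparable if there is an induced action $\kappa\mapsto g\cdot\kappa$ on the motif vertices, so that $g\cdot(\kappa,k)=(g\cdot\kappa,k')$, where $k'$ generally depends on $g,\kappa,k$. An element $g$ acts on $F_v$ if $T_g$ acts as a permutation of the set $F_v=\{p_{\kappa,0}\}$.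 Standing assumption: the group action on the motif vertices is semiseparable. That the matrices of $\mathcal E$ commute with $T_g$ means $T_gA=AT_g$ for all $A\in\mathcal E$. Let $H$ be the cyclic group generated by $g$. Write $\mathcal H_v^{\mathcal E}=\mathbb R^{d|F_v|}\oplus\mathcal E$ and identify $(u,A)\in\mathcal H_v^{\mathcal E}$ with the velocity vector $\tilde u=(\tilde u_{\kappa,k})$, $\tilde u_{\kappa,k}=u_\kappa-AZk$, in $\prod_{\kappa,k}\mathbb R^d$. The representation $\pi_v^{\mathcal E}$ of $H$ on $\mathcal H_v^{\mathcal E}$ is the restriction to this space, under this identification, of the representation $\tilde\rho_v$ on $\prod_{\kappa,k}\mathbb R^d$ given by $(\tilde\rho_v(g)\tilde u)_{\kappa,k}=T_g\,\tilde u_{g^{-1}\cdot(\kappa,k)}$. The representation $\pi_e$ on $\mathbb R^{|F_e|}$ is the restriction, to periodic edge vectors ($w_{e,k}=w_{e,0}$ for all $k$, identified with vectors in $\mathbb R^{|F_e|}$), of the representation $(\rho_e(g)w)_{e,k}=w_{g^{-1}\cdot(e,k)}$; it is a permutation representation on edge classes. The remaining representations are subrepresentations of these. With $\mathcal H_{\rm fl}^{\mathcal E}=\ker R(\mathcal M,\mathcal E)$ (an invariant subspace for $\pi_v^{\mathcal E}$): - $\pi_{\rm rig}^{\mathcal E}$ is the restriction of $\pi_v^{\mathcal E}$ to the invariant subspace $\mathcal H_{\rm rig}^{\mathcal E}=\mathcal H_v^{\mathcal E}\cap\mathcal H_{\rm rig}$, where $\mathcal H_{\rm rig}$ is the space of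 infinitesimal flexes in $\prod_{\kappa,k}\mathbb R^d$ induced by isometries of $\mathbb R^d$ (infinitesimal rigid motions); - $\pi_{\rm mech}^{\mathcal E}$ is the restriction of $\pi_v^{\mathcal E}$ to the invariant subspace $\mathcal H_{\rm mech}^{\mathcal E}=\mathcal H_{\rm fl}^{\mathcal E}\ominus\mathcal H_{\rm rig}^{\mathcal E}$ (orthogonal complement of $\mathcal H_{\rm rig}^{\mathcal E}$ in $\mathcal H_{\rm fl}^{\mathcal E}$); - $\pi_{\rm str}^{\mathcal E}$ is the restriction of $\pi_e$ to the invariant subspace $\mathcal H_{\rm str}^{\mathcal E}=\operatorname{coker}R(\mathcal M,\mathcal E)$, the orthogonal complement of the range of $R(\mathcal M,\mathcal E)$ in $\mathbb R^{|F_e|}$. *)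

(* Defs.v *)
From HB Require Import structures.
From mathcomp Require Import all_boot all_order all_algebra.
From mathcomp Require Import all_classical all_reals.

Set Implicit Arguments.
Unset Strict Implicit.
Unset Printing Implicit Defensive.

Import Order.TTheory GRing.Theory Num.Theory.

Local Open Scope classical_set_scope.
Local Open Scope ring_scope.

Section InnerProducts.
Variable R : realType.

Definition mxdot m n (x y : 'M[R]_(m, n)) : R := \sum_i \sum_j x i j * y i j.

Definition enorm n (x : 'cV[R]_n) : R := Num.sqrt (mxdot x x).

Variables (V : vectType R) (dot : V -> V -> R).
Implicit Types (U W : set V).

Definition orthocomp U W : set V :=
  [set x | U x /\ forall y, W y -> dot x y = 0].

Definition oproj U (x : V) : V :=
  xget 0 [set y | U y /\ forall z, U z -> dot (x - y) z = 0].

Definition vspace_of U : {vspace V} :=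
  xget 0%VS [set S : {vspace V} | forall x, x \in S <-> U x].

(* Trace of x |-> oproj U (f x) on the linear subspace U.  If f maps U to U
   this is the trace of the restriction of f to U (trace_on_invariant below);
   in general it is the trace of the compression of f to U. *)
Definition trace_on U (f : V -> V) : R :=
  let b := vbasis (vspace_of U) in
  \tr (\matrix_(i, j < \dim (vspace_of U)) coord b j (oproj U (f b`_i))).

Lemma vspace_ofP U :
  U 0 -> (forall (a : R) x y, U x -> U y -> U (a *: x + y)) ->
  forall x, x \in vspace_of U <-> U x.
Proof.
move=> U0 Ulin; rewrite /vspace_of; set Q := (X in xget _ X).
suff exQ : exists S, Q S by exact: (xgetPex 0%VS exQ).
pose P n := `[< exists S : {vspace V}, \dim S = n /\ forall x, x \in S -> U x >].
have exP : exists n, P n.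
  exists 0%N; apply/asboolP; exists 0%VS; rewrite dimv0; split=> // x.
  by rewrite memv0 => /eqP ->.
have leP n : P n -> (n <= \dim {:V})%N.
  by move=> /asboolP[S [<- _]]; exact/dimvS/subvf.
case: (ex_maxnP exP leP) => n /asboolP[S [dimS SU]] maxn.
exists S; rewrite /Q /= => x; split; first exact: SU.
move=> Ux; have : P (\dim (S + <[x]>)%VS).
  apply/asboolP; exists (S + <[x]>)%VS; split=> // y.
  move=> /memv_addP[s sS [z /vlineP[a ->] ->]].
  by rewrite addrC; apply: Ulin => //; exact: SU.
move=> /maxn; rewrite -dimS => le_dim.
have /eqP -> : (S == S + <[x]>)%VS by rewrite eqEdim addvSl.
by rewrite (subvP (addvSr _ _)) // memv_line.
Qed.

Lemma trace_on_invariant U (f : V -> V) :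
  (forall x, x != 0 -> 0 < dot x x) ->
  U 0 -> (forall (a : R) x y, U x -> U y -> U (a *: x + y)) ->
  (forall x y z, dot (x - y) z = dot x z - dot y z) ->
  (forall x, U x -> U (f x)) ->
  let b := vbasis (vspace_of U) in
  trace_on U f =
    \tr (\matrix_(i, j < \dim (vspace_of U)) coord b j (f b`_i)).
Proof.
move=> dot_gt0 U0 Ulin dotBl fU /=; rewrite /trace_on; congr (\tr _).
apply/matrixP => i j; rewrite !mxE; congr (coord _ _ _).
have Ufb : U (f (vbasis (vspace_of U))`_i).
  apply/fU/(vspace_ofP U0 Ulin)/vbasis_mem/mem_nth.
  by rewrite size_tuple.
apply: xget_unique; first by split=> // z _; rewrite dotBl subrr.
move=> y [Uy xy]; apply/eqP; rewrite eq_sym -subr_eq0; apply/negPn/negP => /dot_gt0.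
rewrite xy ?ltxx // addrC -scaleN1r; exact: Ulin.
Qed.

End InnerProducts.

Section CrystalFrameworks.
Variables (R : realType) (d : nat).

Local Notation point := 'cV[R]_d.

Definition intv (k : 'cV[int]_d) : point := map_mx intr k.

Definition transl (Z : 'M[R]_d) (k : 'cV[int]_d) (x : point) : point :=
  x + Z *m intv k.

(* The framework edge [x, y] is represented by its set of endpoints.  The motif
   edge e is given through an ordered pair of labels ((kappa, l), (tau, l'));
   the matrix R(M, R^(d^2)) does not depend on the order. *)
Record crystal := Crystal {
  nvert : nat;
  nedge : nat;
  motif : 'I_nvert -> point;
  period : 'M[R]_d;
  ends : 'I_nedge -> ('I_nvert * 'cV[int]_d) * ('I_nvert * 'cV[int]_d);
  fpoint := (fun a => transl period a.2 (motif a.1))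
    : 'I_nvert * 'cV[int]_d -> point;
  fedge := (fun b => [set transl period b.2 (fpoint (ends b.1).1);
                          transl period b.2 (fpoint (ends b.1).2)])
    : 'I_nedge * 'cV[int]_d -> set point;
  nvert_gt0 : (0 < nvert)%N;
  period_unit : period \in unitmx;
  fpoint_inj : injective fpoint;
  ends_neq : forall e, fpoint (ends e).1 <> fpoint (ends e).2;
  fedge_inj : injective fedge
}.

Variable C : crystal.

Local Notation t := (nvert C).
Local Notation m := (nedge C).
Local Notation Z := (period C).

Definition vlabel : Type := 'I_t * 'cV[int]_d.
Definition elabel : Type := 'I_m * 'cV[int]_d.

Definition evec (e : 'I_m) : point :=
  fpoint (ends e).1 - fpoint (ends e).2.

Definition expo (e : 'I_m) : 'cV[int]_d := (ends e).2.2 - (ends e).1.2.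

(* Vectors (u, A) of R^(d|F_v|) (+) R^(d^2); column kappa of u is u_kappa. *)
Definition vdata : Type := ('M[R]_(d, t) * 'M[R]_d)%type.
HB.instance Definition _ := Vector.on vdata.

(* mxvec is row-major, whence the transposes: the d|F_v| + d^2 coordinates are
   u_1, ..., u_t followed by the columns of the second component. *)
Definition coords (u : 'M[R]_(d, t)) (M : 'M[R]_d) : 'rV[R]_(t * d + d * d) :=
  row_mx (mxvec u^T) (mxvec M^T).

Definition rigidity_mx : 'M[R]_(m, t * d + d * d) :=
  \matrix_(e < m)
    coords (\matrix_(i, kappa) (((kappa == (ends e).1.1)%:R
                                  - (kappa == (ends e).2.1)%:R) * evec e i 0))
            (\matrix_(i, j) ((expo e j 0)%:~R * evec e i 0)).

Definition rigidity (x : vdata) : 'cV[R]_m :=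
  rigidity_mx *m (coords x.1 (x.2 *m Z))^T.

Definition vdata_dot (x y : vdata) : R := mxdot x.1 y.1 + mxdot x.2 y.2.

(* The identification (u, A) |-> (u_kappa - A Z k)_(kappa, k). *)
Definition velocity (x : vdata) : vlabel -> point :=
  fun a => col a.1 x.1 - x.2 *m Z *m intv a.2.

Definition periodic (w : 'cV[R]_m) : elabel -> R := fun b => w b.1 0.

Definition isometry (T : point -> point) : Prop :=
  forall x y, enorm (T x - T y) = enorm (x - y).

Definition space_group : set (point -> point) :=
  [set T | [/\ isometry T,
               T @` range (@fpoint C) = range (@fpoint C) &
               (fun s => T @` s) @` range (@fedge C) = range (@fedge C)]].

Definition ginv (T : point -> point) : point -> point :=
  fun y => xget 0 [set x | T x = y].

Definition cyclic_group (T : point -> point) : set (point -> point) :=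
  [set h | exists n, h = iter n T \/ h = iter n (ginv T)].

(* Matrix of the linear part of an isometry; isometries act on velocities
   through their linear part. *)
Definition lin_part (T : point -> point) : 'M[R]_d :=
  \matrix_(i, j) (T (delta_mx j 0) - T 0) i 0.

Definition vact (T : point -> point) (a : vlabel) : vlabel :=
  xget a [set b | fpoint b = T (fpoint a)].

Definition eact (T : point -> point) (a : elabel) : elabel :=
  xget a [set b | fedge b = T @` fedge a].

Definition semiseparable (T : point -> point) : Prop :=
  exists s : 'I_t -> 'I_t, forall kappa k, (vact T (kappa, k)).1 = s kappa.

Definition acts_on_motif (T : point -> point) : Prop :=
  T @` range (@motif C) = range (@motif C).

Definition rho_v (T : point -> point) (w : vlabel -> point) : vlabel -> point :=
  fun a => lin_part T *m w (vact (ginv T) a).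

Definition rho_e (T : point -> point) (w : elabel -> R) : elabel -> R :=
  fun b => w (eact (ginv T) b).

Variable E : {vspace 'M[R]_d}.

Definition H_v : set vdata := [set x | x.2 \in E].

Definition H_fl : set vdata := [set x | H_v x /\ rigidity x = 0].

Definition rigid_motions : set (vlabel -> point) :=
  [set w | exists (S : 'M[R]_d) (b : point),
    S^T = - S /\ forall a, w a = S *m fpoint a + b].

Definition H_rig : set vdata := [set x | H_v x /\ rigid_motions (velocity x)].

Definition H_mech : set vdata := orthocomp vdata_dot H_fl H_rig.

Definition H_str : set 'cV[R]_m := orthocomp (@mxdot R m 1) setT (rigidity @` H_v).

Definition pi_v (T : point -> point) (x : vdata) : vdata :=
  xget 0 [set y | H_v y /\ velocity y = rho_v T (velocity x)].

Definition pi_e (T : point -> point) (w : 'cV[R]_m) : 'cV[R]_m :=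
  xget 0 [set z | periodic z = rho_e T (periodic w)].

Definition tr_v T : R := trace_on vdata_dot H_v (pi_v T).
Definition tr_rig T : R := trace_on vdata_dot H_rig (pi_v T).
(* H_mech need not be invariant when T moves points of F_v out of F_v. *)
Definition tr_mech T : R := trace_on vdata_dot H_mech (pi_v T).
Definition tr_e T : R := trace_on (@mxdot R m 1) setT (pi_e T).
Definition tr_str T : R := trace_on (@mxdot R m 1) H_str (pi_e T).

End CrystalFrameworks.

(* Main.v *)
From HB Require Import structures.
Require Import Defs.
From mathcomp Require Import all_boot all_order all_algebra.
From mathcomp Require Import all_classical all_reals.
From mathcomp Require Import lra ring.

(** The formula is an Euler characteristic for traces.  The rigidity map is a
    linear map from [H_v] to the edge space, [H_fl] is its kernel and [H_str] its
    cokernel.  If it intertwines endomorphisms [f] and [h], it induces an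
    isomorphism from [H_v / H_fl] to its range that carries [f] to [h], so that
    tr_v - tr_fl = tr_e - tr_str.  Rigid motions are flexes, and [H_fl] is the
    orthogonal sum of [H_rig] and [H_mech], so that tr_fl = tr_rig + tr_mech.
    Eliminating tr_fl gives the claim ([trace_euler_formula]).

    All traces are traces of compressions: [trace_on] of [f] over [U] is the
    trace of [P \o f] on the whole space, with [P] the orthogonal projection onto
    [U] ([trace_on_oproj]).  Compression traces add up over orthogonal sums even
    when the summands are not invariant, which matters for [H_mech].

    The geometry consists of three facts.  An isometry is [x |-> L x + c] with
    [L] orthogonal ([isometry_affine], [lin_part_orthogonal]).  Semiseparability
    of the inverse forces [L^T] to preserve the lattice of periods
    ([vact_translate]), so that the symmetry acts on periodic edge vectors, and,
    when [L] commutes with the affine velocity matrices, also on velocity data,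
    fixing the affine part ([velocity_pull]).  Finally a row of the rigidity matrix
    tests the relative velocity of the ends of an edge against the edge vector
    ([rigidityE]), and that is invariant under isometries: the two actions are
    intertwined by the rigidity map ([rigidity_pull]). *)

Set Implicit Arguments.
Unset Strict Implicit.
Unset Printing Implicit Defensive.

Import Order.TTheory GRing.Theory Num.Theory.
Import VectorInternalTheory.

Local Open Scope classical_set_scope.
Local Open Scope ring_scope.

(** * Traces of endomorphisms *)

Section LinearTrace.
Variable K : fieldType.
Implicit Types V W : vectType K.

(** Computed in the coordinates that every [vectType] carries; the choice is
    immaterial by [endo_traceC]. *)
Definition endo_trace V (f : 'End(V)) : K := \tr (f2mx f).

Lemma mul_f2mx V W (f : 'Hom(V, W)) x : x *m f2mx f = v2r (f (r2v x)).
Proof. by rewrite unlock /= !r2vK. Qed.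

Lemma endo_traceC V W (f : 'Hom(V, W)) (h : 'Hom(W, V)) :
  endo_trace (h \o f)%VF = endo_trace (f \o h)%VF.
Proof.
have f2mx_comp V1 V2 (u : 'Hom(V1, V2)) (v : 'Hom(V2, V1)) :
    f2mx (v \o u)%VF = f2mx u *m f2mx v.
  apply/row_matrixP => i; rewrite !rowE.
  by rewrite mul_f2mx comp_lfunE mulmxA !mul_f2mx v2rK.
by rewrite /endo_trace !f2mx_comp mxtrace_mulC.
Qed.

Lemma endo_traceB V (f h : 'End(V)) : endo_trace (f - h) = endo_trace f - endo_trace h.
Proof.
rewrite /endo_trace -linearB /=; congr (\tr _).
apply/row_matrixP => i; rewrite !rowE.
by rewrite mulmxBr !mul_f2mx add_lfunE opp_lfunE linearB.
Qed.

(** An endomorphism given as a sum of rank one maps factors through [K^n];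
    cyclicity of the trace moves the computation to an n x n matrix.  This
    identifies a trace taken in a basis of a subspace with a trace on the whole
    space. *)
Lemma endo_trace_sum V n (f : 'End(V)) (phi : 'I_n -> {linear V -> K^o})
    (b : 'I_n -> V) :
  (forall x, f x = \sum_j phi j x *: b j) ->
  endo_trace f = \sum_j phi j (b j).
Proof.
move=> fE; pose L := \matrix_(i, j) phi j (r2v (delta_mx 0 i)).
pose B := \matrix_(j < n) v2r (b j).
have -> : endo_trace f = \tr (L *m B).
  rewrite /endo_trace; congr (\tr _); apply/row_matrixP => i.
  rewrite rowE mul_f2mx fE row_mul linear_sum /= mulmx_sum_row.
  by apply: eq_bigr => j _; rewrite linearZ /= rowK !mxE.
rewrite mxtrace_mulC /mxtrace; apply: eq_bigr => j _; rewrite !mxE.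
rewrite -[in RHS](v2rK (b j)) [in RHS](row_sum_delta (v2r (b j))).
rewrite !linear_sum; apply: eq_bigr => i _.
by rewrite !linearZ /= !mxE.
Qed.

End LinearTrace.

(** * Orthogonal projections and compressions *)

Section OrthogonalProjection.
Variables (R : realType) (V : vectType R).

Definition inner_product (dot : V -> V -> R) : Prop :=
  [/\ forall a x y z, dot (a *: x + y) z = a * dot x z + dot y z,
      forall x y, dot x y = dot y x
    & forall x, x != 0 -> 0 < dot x x].

Variable dot : V -> V -> R.
Hypothesis dotP : inner_product dot.

Definition is_oproj (S : {vspace V}) (P : 'End(V)) : Prop :=
  (forall x, P x \in S) /\ forall x z, z \in S -> dot (x - P x) z = 0.

Lemma dot0l z : dot 0 z = 0.
Proof.
case: dotP => lin _ _; have := lin (-1) z z z.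
by rewrite scaleN1r addNr mulN1r addNr.
Qed.

Lemma dotDl x y z : dot (x + y) z = dot x z + dot y z.
Proof. by case: dotP => lin _ _; rewrite -[x in LHS]scale1r lin mul1r. Qed.

Lemma dotZl a x z : dot (a *: x) z = a * dot x z.
Proof. by case: dotP => lin _ _; rewrite -[_ *: _]addr0 lin dot0l addr0. Qed.

Lemma dotBl x y z : dot (x - y) z = dot x z - dot y z.
Proof. by rewrite dotDl -scaleN1r dotZl mulN1r. Qed.

Lemma dot_eq0 x : dot x x = 0 -> x = 0.
Proof.
case: dotP => _ _ pos dx0; apply/eqP/negPn/negP => /pos.
by rewrite dx0 ltxx.
Qed.

Lemma dot_ge0 x : 0 <= dot x x.
Proof.
by case: dotP => _ _ pos; have [->|/pos/ltW//] := eqVneq x 0; rewrite dot0l.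
Qed.

Lemma dot_vbasis0 (S : {vspace V}) x :
  (forall j : 'I_(\dim S), dot x (vbasis S)`_j = 0) ->
  forall z, z \in S -> dot x z = 0.
Proof.
have [_ dC _] := dotP => x0 z Sz; rewrite dC (coord_vbasis Sz).
elim/big_ind : _ => [|y w y0 w0|j _]; first exact: dot0l.
  by rewrite dotDl y0 w0 addr0.
by rewrite dotZl dC x0 mulr0.
Qed.

(** Pairing with a basis of [S] gives [phi : V -> R^n] which is injective on
    [S], hence bijective from [S] to [R^n] by dimension.  The projection of [x]
    is the point of [S] with the same image as [x] under [phi]. *)
Lemma is_oproj_exists (S : {vspace V}) : exists P, is_oproj S P.
Proof.
pose phi0 x : 'rV[R]_(\dim S) := \row_j dot x (vbasis S)`_j.
have phi0_lin : linear phi0.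
  by move=> a x y; apply/rowP => j; rewrite !mxE dotDl dotZl.
pose phiL := GRing.isLinear.Build _ _ _ _ phi0 phi0_lin.
pose phi1 : {linear V -> 'rV[R]_(\dim S)} := HB.pack phi0 phiL.
pose phi := linfun phi1.
have phiE x j : phi x 0 j = dot x (vbasis S)`_j by rewrite lfunE /= mxE.
have ker0 : (S :&: lker phi = 0)%VS.
  apply/eqP; rewrite -subv0; apply/subvP => x /memv_capP[Sx].
  rewrite memv_ker => /eqP phix; rewrite memv0; apply/eqP/dot_eq0.
  by apply: (dot_vbasis0 _ Sx) => j; rewrite -phiE phix mxE.
have img : limg (phi \o projv S)%VF = fullv.
  apply/eqP; rewrite limg_comp limg_proj eqEdim subvf dimvf /= limg_dim_eq //.
  by rewrite /dim /= mul1n.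
exists (projv S \o (phi \o projv S)^-1 \o phi)%VF; split=> [x|x z Sz].
  by rewrite !comp_lfunE memv_proj.
apply: dot_vbasis0 Sz => j; rewrite dotBl -!phiE; apply/eqP; rewrite subr_eq0.
rewrite !comp_lfunE -(comp_lfunE phi) limg_lfunVK //.
by rewrite img memvf.
Qed.

Lemma is_oproj_unique (S : {vspace V}) P x y :
  is_oproj S P -> y \in S -> (forall z, z \in S -> dot (x - y) z = 0) -> y = P x.
Proof.
case=> PS Port Sy yort; apply/eqP; rewrite -subr_eq0; apply/eqP/dot_eq0.
have Sd : y - P x \in S by rewrite rpredB.
have E : y - P x = (x - P x) - (x - y) by rewrite opprB [RHS]addrC addrA subrK.
by rewrite [X in dot X _]E dotBl Port // yort // subrr.
Qed.

Definition coord_lin (S : {vspace V}) (f : 'End(V)) (j : 'I_(\dim S)) (x : V) : R^o :=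
  coord (vbasis S) j (f x).

Lemma coord_lin_is_linear S f j : linear (@coord_lin S f j).
Proof. by move=> a x y; rewrite /coord_lin !linearP. Qed.

HB.instance Definition _ S f j :=
  GRing.isLinear.Build R V R^o _ (@coord_lin S f j) (@coord_lin_is_linear S f j).

(** The bridge from [trace_on] to linear algebra: only the values of the map on
    [U] enter, and the basis of [U] disappears. *)
Lemma trace_on_oproj (U : set V) (S : {vspace V}) P (f : 'End(V)) (f0 : V -> V) :
  (forall x, x \in S <-> U x) -> is_oproj S P -> (forall x, U x -> f0 x = f x) ->
  trace_on dot U f0 = endo_trace (P \o f)%VF.
Proof.
move=> SU PP f0f; have [PS Port] := PP.
have US : vspace_of U = S.
  apply/vspaceP => x.
  have [U0 Ulin] : U 0 /\ forall (a : R) x y, U x -> U y -> U (a *: x + y).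
    split; first by apply/SU; rewrite mem0v.
    by move=> a y z /SU Sy /SU Sz; apply/SU; rewrite memvD ?memvZ.
  apply/idP/idP; first by move/(vspace_ofP U0 Ulin)/SU.
  by move/SU/(vspace_ofP U0 Ulin).
rewrite /trace_on US /=; set b := vbasis S.
rewrite (@endo_trace_sum _ _ _ _ (fun j => @coord_lin S (P \o f)%VF j) (fun j => b`_j)).
  rewrite /mxtrace; apply: eq_bigr => j _; rewrite mxE /= /coord_lin.
  congr (coord _ _ _); rewrite comp_lfunE.
  have Ub : U b`_j by apply/SU/vbasis_mem/mem_nth; rewrite size_tuple.
  rewrite f0f //; apply: xget_unique.
    by split=> [|z /SU Sz]; [exact/SU/PS|exact: Port].
  move=> y [/SU Sy yort]; apply: is_oproj_unique => // z /SU; exact: yort.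
move=> x; have Sx : (P \o f)%VF x \in S by rewrite comp_lfunE; exact: PS.
exact: coord_vbasis Sx.
Qed.

Lemma is_oproj_id (S : {vspace V}) P x : is_oproj S P -> x \in S -> P x = x.
Proof.
move=> PP Sx; apply/esym/(is_oproj_unique PP) => // z _.
by rewrite subrr dot0l.
Qed.

(** Since the projection onto an orthogonal complement is a difference of
    projections, [trace_on] is additive over orthogonal decompositions whether
    or not the summands are invariant. *)
Lemma is_oproj_orthocomp (S S' : {vspace V}) P P' :
  is_oproj S P -> is_oproj S' P' -> (S' <= S)%VS ->
  exists2 S2 : {vspace V}, is_oproj S2 (P - P') &
  forall x, x \in S2 <-> (x \in S /\ forall y, y \in S' -> dot x y = 0).
Proof.
move=> PP PP' /subvP sS; have [_ dC _] := dotP.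
have [PS Port] := PP; have [PS' Port'] := PP'.
have E x : x \in limg (P - P') <-> (x \in S /\ forall y, y \in S' -> dot x y = 0).
  split.
    case/memv_imgP=> y _ ->; rewrite add_lfunE opp_lfunE; split.
      by rewrite rpredB ?PS // sS ?PS'.
    move=> z Sz; have -> : P y - P' y = (y - P' y) - (y - P y).
      by rewrite opprB [RHS]addrC addrA subrK.
    by rewrite dotBl Port' // Port ?sS // subrr.
  case=> Sx xort; apply/memv_imgP; exists x; rewrite ?memvf //.
  rewrite add_lfunE opp_lfunE (is_oproj_id PP) //.
  have <- : 0 = P' x by apply: (is_oproj_unique PP'); rewrite ?mem0v // subr0.
  by rewrite subr0.
exists (limg (P - P')) => //; split=> [x|x z /E[Sz zort]].
  by rewrite memv_img ?memvf.
rewrite add_lfunE opp_lfunE opprB addrCA dotDl Port // addr0.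
by rewrite dC zort ?PS'.
Qed.

End OrthogonalProjection.

(** * The trace formula for an intertwining map *)

Section EulerFormula.
Variables (R : realType) (V W : vectType R).
Variables (dotV : V -> V -> R) (dotW : W -> W -> R).
Hypotheses (dotVP : inner_product dotV) (dotWP : inner_product dotW).

Lemma oproj_comp (S S' : {vspace V}) P P' x :
  is_oproj dotV S P -> is_oproj dotV S' P' -> (S' <= S)%VS -> P' (P x) = P' x.
Proof.
move=> [PS Port] PP' /subvP sS; have [PS' Port'] := PP'.
apply: (is_oproj_unique dotVP PP') => // z Sz.
have -> : x - P' (P x) = (x - P x) + (P x - P' (P x)) by rewrite addrA subrK.
by rewrite (dotDl dotVP) Port ?sS // Port' // addr0.
Qed.

(** The restriction of [r] to the orthogonal complement of its kernel in [S] is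
    an isomorphism onto [r @: S] which carries [f] to [h], up to [ker r].  With
    [r' := r \o P] and [s] the partial inverse of [r'] one has [r' \o s = P'] and
    [s \o r' = Q], where [Q := P - P0] is the projection onto that complement,
    and the trace can be carried across by cyclicity. *)
Lemma endo_trace_intertwine (r : 'Hom(V, W)) (f : 'End(V)) (h : 'End(W))
    (S : {vspace V}) P P0 P' :
  (forall x, x \in S -> f x \in S) ->
  (forall x, x \in S -> r (f x) = h (r x)) ->
  is_oproj dotV S P -> is_oproj dotV (S :&: lker r) P0 ->
  is_oproj dotW (r @: S) P' ->
  endo_trace (P' \o h)%VF = endo_trace ((P - P0) \o f)%VF.
Proof.
move=> fS rf PP PP0 PP'.
have [PS Port] := PP; have [P0S P0ort] := PP0; have [P'S _] := PP'.
set Q := (P - P0)%R; have QE x : Q x = P x - P0 x by rewrite add_lfunE opp_lfunE.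
have sub0 : (S :&: lker r <= S)%VS := capvSl _ _.
have rP0 x : r (P0 x) = 0.
  by have /memv_capP[_] := P0S x; rewrite memv_ker => /eqP.
have P0inS x : P0 x \in S by apply: (subvP sub0).
have QS x : Q x \in S by rewrite QE rpredB.
pose r' := (r \o P)%VF.
have r'S x : x \in S -> r' x = r x.
  by move=> Sx; rewrite comp_lfunE (is_oproj_id dotVP PP).
have r'Q x : r' (Q x) = r' x.
  by rewrite r'S // QE linearB /= rP0 subr0 comp_lfunE.
(* [Q] sees its argument only through [r'], so [s] below does not depend on
   the choice of the preimage. *)
have Qker z x : r' z = r' x -> Q z = Q x.
  move=> /eqP; rewrite -subr_eq0 -linearB => /eqP r'0.
  suff : Q (z - x) = 0 by rewrite linearB => /eqP; rewrite subr_eq0 => /eqP.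
  apply/eqP; rewrite QE subr_eq0 -(oproj_comp _ PP PP0) //.
  rewrite (is_oproj_id dotVP PP0) // memv_cap PS /= memv_ker.
  by rewrite -[r _]comp_lfunE -/r' r'0.
have QQ x : Q (Q x) = Q x by apply: Qker; rewrite r'Q.
pose s := (Q \o r'^-1 \o P')%VF.
have im_r' : limg r' = (r @: S)%VS.
  apply/eqP; rewrite eqEsubv; apply/andP; split; apply/subvP => y.
    by case/memv_imgP=> x _ ->; rewrite comp_lfunE memv_img.
  by case/memv_imgP=> x Sx ->; rewrite -(r'S _ Sx) memv_img ?memvf.
have r's : (r' \o s)%VF = P'.
  apply/lfunP => y; rewrite !comp_lfunE -comp_lfunE -/r' r'Q limg_lfunVK //.
  by rewrite im_r' P'S.
have sr' x : s (r' x) = Q x.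
  rewrite !comp_lfunE -[r (P x)]comp_lfunE -/r'; apply: Qker.
  rewrite (is_oproj_id dotWP PP') ?limg_lfunVK //; first by rewrite memv_img ?memvf.
  by rewrite -im_r' memv_img ?memvf.
have sh : (s \o (h \o r'))%VF = (Q \o (f \o Q))%VF.
  apply/lfunP => x; rewrite [LHS]comp_lfunE [in LHS]comp_lfunE -r'Q r'S //.
  rewrite -rf // -(r'S (f _)) ?fS // sr'; by rewrite !comp_lfunE.
(* tr (P' h) = tr (h r' s) = tr (s h r') = tr (Q f Q) = tr (Q f) *)
rewrite endo_traceC -r's comp_lfunA endo_traceC sh endo_traceC -comp_lfunA.
have -> : (Q \o Q)%VF = Q by apply/lfunP => x; rewrite comp_lfunE QQ.
by rewrite endo_traceC.
Qed.

Definition subspace (T : vectType R) (U : set T) : Prop :=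
  U 0 /\ forall (a : R) x y, U x -> U y -> U (a *: x + y).

(** The trace form of rank-nullity: passing from [U] to [ker r] and from [W] to
    the cokernel of [r] removes the same trace from both sides.  The subspace
    [U0] of the kernel is then split off on the left. *)
Theorem trace_euler_formula (U U0 : set V) (r : {linear V -> W}) (f : {linear V -> V})
    (h : {linear W -> W}) (f0 : V -> V) (h0 : W -> W) :
  subspace U -> subspace U0 ->
  (forall x, U0 x -> U x /\ r x = 0) ->
  (forall x, U x -> U (f x)) ->
  (forall x, U x -> r (f x) = h (r x)) ->
  (forall x, U x -> f0 x = f x) -> (forall y, h0 y = h y) ->
  trace_on dotV (orthocomp dotV [set x | U x /\ r x = 0] U0) f0
    - trace_on dotW (orthocomp dotW setT (r @` U)) h0 =
  trace_on dotV U f0 - trace_on dotW setT h0 - trace_on dotV U0 f0.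
Proof.
move=> [Uz Ulin] [U0z U0lin] U0U fU rf f0f h0h.
pose S := vspace_of U; have SU : forall x, x \in S <-> U x := vspace_ofP Uz Ulin.
pose S0 := vspace_of U0; have S0U : forall x, x \in S0 <-> U0 x := vspace_ofP U0z U0lin.
pose rl := linfun r; pose fl := linfun f; pose hl := linfun h.
have rE x : rl x = r x by rewrite lfunE.
have fE x : fl x = f x by rewrite lfunE.
have hE x : hl x = h x by rewrite lfunE.
pose K := (S :&: lker rl)%VS.
have KE x : x \in K <-> U x /\ r x = 0.
  rewrite memv_cap memv_ker rE; split; first by case/andP=> /SU ? /eqP.
  by case=> /SU -> ->; rewrite eqxx.
have ImE y : y \in (rl @: S)%VS <-> (r @` U) y.
  split; first by case/memv_imgP=> x /SU Ux ->; exists x; rewrite ?rE.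
  by case=> x /SU Sx <-; rewrite -rE memv_img.
have S0K : (S0 <= K)%VS by apply/subvP => x /S0U/U0U/KE.
have [P PP] := is_oproj_exists dotVP S.
have [PK PKP] := is_oproj_exists dotVP K.
have [P0 PP0] := is_oproj_exists dotVP S0.
have [Q QP] := is_oproj_exists dotWP (rl @: S).
have [I IP] := is_oproj_exists dotWP fullv.
have [M MP ME] := is_oproj_orthocomp dotVP PKP PP0 S0K.
have [N NP NE] := is_oproj_orthocomp dotWP IP QP (subvf _).
have f0fl x : U x -> f0 x = fl x by move=> Ux; rewrite fE f0f.
have h0hl y : h0 y = hl y by rewrite hE.
rewrite (trace_on_oproj dotVP (S := M) (P := PK - P0) (f := fl)) //; last 2 first.
- move=> x; rewrite ME; split=> [[/KE ? xort]|[/KE ? xort]]; split=> // y.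
    by move/S0U; apply: xort.
  by move/S0U; apply: xort.
- by move=> x [[Ux _] _]; exact: f0fl.
rewrite (trace_on_oproj dotWP (S := N) (P := I - Q) (f := hl)) //; last first.
  move=> y; rewrite NE; split=> [[_ yort]|[_ yort]]; split; rewrite ?memvf // => z.
    by move/ImE; apply: yort.
  by move/ImE; apply: yort.
rewrite (trace_on_oproj dotVP SU PP f0fl).
rewrite (trace_on_oproj dotVP S0U PP0 (f := fl)); last first.
  by move=> x /U0U[Ux _]; exact: f0fl.
rewrite (trace_on_oproj dotWP (S := fullv) (P := I) (f := hl)) //; last first.
  by move=> y; rewrite memvf.
have tw : endo_trace (Q \o hl)%VF = endo_trace ((P - PK) \o fl)%VF.
  apply: endo_trace_intertwine PP PKP QP => x /SU Ux; first by rewrite fE; apply/SU/fU.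
  by rewrite !rE fE rf // hE.
rewrite !comp_lfunDl !comp_lfunNl !endo_traceB in tw *.
rewrite tw; lra.
Qed.

End EulerFormula.

(** * Isometries of Euclidean space *)

Section EuclideanIsometries.
Variable R : realType.

Lemma mxdot_inner m n : inner_product (@mxdot R m n).
Proof.
split=> [a x y z|x y|x x0]; rewrite /mxdot.
- rewrite mulr_sumr -big_split; apply: eq_bigr => i _ /=.
  rewrite mulr_sumr -big_split; apply: eq_bigr => j _ /=.
  by rewrite !mxE mulrDl mulrA.
- by apply: eq_bigr => i _; apply: eq_bigr => j _; rewrite mulrC.
have ge0 i j : 0 <= x i j * x i j by rewrite -expr2 sqr_ge0.
have S0 : 0 <= \sum_i \sum_j x i j * x i j.
  by rewrite sumr_ge0 // => i _; rewrite sumr_ge0.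
rewrite lt_def S0 andbT; apply: contra x0 => /eqP s0.
apply/eqP/matrixP => i j; rewrite mxE; apply/eqP.
have r0 : \sum_j x i j * x i j = 0.
  by apply: (psumr_eq0P _ s0) => // k _; rewrite sumr_ge0.
have : x i j * x i j = 0 by apply: (psumr_eq0P _ r0).
by move/eqP; rewrite -expr2 sqrf_eq0.
Qed.

Lemma pair_dot_inner (V W : vectType R) dotV dotW :
  @inner_product R V dotV -> @inner_product R W dotW ->
  @inner_product R (V * W)%type (fun x y => dotV x.1 y.1 + dotW x.2 y.2).
Proof.
move=> VP WP; have [Vl VC Vp] := VP; have [Wl WC Wp] := WP.
split=> [a x y z|x y|[x y] /=]; first by rewrite /= Vl Wl mulrDr addrACA.
  by rewrite VC WC.
rewrite xpair_eqE negb_and => /orP[/Vp|/Wp] ?.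
  exact: ltr_wpDr (dot_ge0 WP y) _.
exact: ltr_wpDl (dot_ge0 VP x) _.
Qed.

Lemma mxdotZr m n a (x y : 'M[R]_(m, n)) : mxdot x (a *: y) = a * mxdot x y.
Proof.
have [_ dC _] := mxdot_inner m n.
by rewrite dC (dotZl (mxdot_inner m n)) dC.
Qed.

Lemma mxdotNN m n (x y : 'M[R]_(m, n)) : mxdot (- x) (- y) = mxdot x y.
Proof.
rewrite -scaleN1r -(scaleN1r y) mxdotZr (dotZl (mxdot_inner m n)).
by rewrite mulrA mulrNN !mul1r.
Qed.

Lemma mxdotBr m n (x y z : 'M[R]_(m, n)) : mxdot x (y - z) = mxdot x y - mxdot x z.
Proof.
have [_ dC _] := mxdot_inner m n.
by rewrite dC (dotBl (mxdot_inner m n)) !(dC _ x).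
Qed.

Lemma mxdot_adj n m (M : 'M[R]_(m, n)) (x : 'cV_n) y :
  mxdot (M *m x) y = mxdot x (M^T *m y).
Proof.
have E p (u v : 'cV[R]_p) : mxdot u v = (u^T *m v) 0 0.
  by rewrite /mxdot mxE; apply: eq_bigr => i _; rewrite big_ord1 mxE.
by rewrite !E trmx_mul mulmxA.
Qed.

Variable d : nat.
Variable g : 'cV[R]_d -> 'cV[R]_d.
Hypothesis gP : Defs.isometry g.

Local Notation L := (lin_part g).
Local Notation dotP := (mxdot_inner d 1).

(** Polarization: the inner product is determined by distances. *)
Lemma isometry_dot x y : mxdot (g x - g 0) (g y - g 0) = mxdot x y.
Proof.
have sq (u v : 'cV[R]_d) : mxdot (g u - g v) (g u - g v) = mxdot (u - v) (u - v).
  rewrite -[LHS]sqr_sqrtr ?(dot_ge0 dotP) // -[RHS]sqr_sqrtr ?(dot_ge0 dotP) //.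
  by congr (_ ^+ 2); exact: gP.
have sqB (u v : 'cV[R]_d) : mxdot (u - v) (u - v) = mxdot u u - 2 * mxdot u v + mxdot v v.
  have [_ dC _] := dotP.
  rewrite mxdotBr !(dotBl dotP) (dC v u); ring.
have := sq x y.
have -> : g x - g y = (g x - g 0) - (g y - g 0) by rewrite opprB addrA subrK.
rewrite sqB [RHS]sqB !sq !subr0; lra.
Qed.

(** With [h u := g u - g 0], the defect [D] of linearity of [h] is orthogonal to
    every value of [h] since [h] preserves inner products; but [D] is itself a
    combination of values of [h], so [D = 0]. *)
Lemma isometry_affine x : g x = L *m x + g 0.
Proof.
have [h hE] : exists h : 'cV[R]_d -> 'cV[R]_d, forall u, h u = g u - g 0.
  by exists (fun u => g u - g 0).
have hdot u v : mxdot (h u) (h v) = mxdot u v by rewrite !hE isometry_dot.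
have h_lin : linear h.
  move=> a u v; apply/eqP; rewrite -subr_eq0; apply/eqP/(dot_eq0 dotP).
  set D := _ - _.
  have Dh z : mxdot D (h z) = 0.
    rewrite /D (dotBl dotP) (dotDl dotP) (dotZl dotP) !hdot.
    by rewrite (dotDl dotP) (dotZl dotP) subrr.
  have [_ dC _] := dotP.
  have DE : D = h (a *: u + v) - (a *: h u + h v) by [].
  rewrite [X in mxdot _ X]DE; move: D Dh {DE} => D Dh.
  rewrite mxdotBr Dh dC (dotDl dotP) (dotZl dotP) !(dC _ D) !Dh.
  by rewrite mulr0 addr0 subrr.
pose hL := GRing.isLinear.Build _ _ _ _ h h_lin.
pose hl : {linear 'cV[R]_d -> 'cV[R]_d} := HB.pack h hL.
have -> : g x = hl x + g 0 by rewrite /= hE subrK.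
congr (_ + _); rewrite [in LHS](matrix_sum_delta x) linear_sum.
apply/colP => i; rewrite summxE mxE; apply: eq_bigr => j _.
by rewrite big_ord1 linearZ /= hE !mxE mulrC.
Qed.

Lemma lin_part_orthogonal : L^T *m L = 1%:M.
Proof.
apply/matrixP => i j; have := isometry_dot (delta_mx i 0) (delta_mx j 0).
rewrite (isometry_affine (delta_mx i 0)) (isometry_affine (delta_mx j 0)) !addrK => E.
transitivity (mxdot (delta_mx i 0 : 'cV[R]_d) (delta_mx j 0)).
  rewrite -E /mxdot mxE -!colE.
  by apply: eq_bigr => k _; rewrite big_ord1 !mxE.
rewrite /mxdot (bigD1 i) //= !big_ord1 big1 ?addr0.
  by rewrite !mxE !eqxx !andbT mul1r.
by move=> k ki; rewrite big_ord1 !mxE (negPf ki) mul0r.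
Qed.

Lemma isometry_solve x y : g x = y <-> x = L^T *m (y - g 0).
Proof.
have LLt := mulmx1C lin_part_orthogonal.
split=> [<-|->].
  by rewrite (isometry_affine x) addrK mulmxA lin_part_orthogonal mul1mx.
by rewrite isometry_affine mulmxA LLt mul1mx subrK.
Qed.

Lemma ginvE y : ginv g y = L^T *m (y - g 0).
Proof.
apply: xget_unique => [|x /isometry_solve //]; exact: (isometry_solve _ _).2.
Qed.

Lemma ginvK x : ginv g (g x) = x.
Proof. by rewrite ginvE; apply/esym/isometry_solve. Qed.

Lemma ginvB x y : ginv g x - ginv g y = L^T *m (x - y).
Proof. by rewrite !ginvE -mulmxBr opprB addrA subrK. Qed.

Lemma ginvKV y : g (ginv g y) = y.
Proof. by rewrite ginvE; apply/isometry_solve. Qed.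

Lemma ginv_inj : injective (ginv g).
Proof. exact: can_inj ginvKV. Qed.

End EuclideanIsometries.

(** * Velocities and the rigidity map *)

Lemma intvD d (k l : 'cV[int]_d) (R : realType) : intv R (k + l) = intv R k + intv R l.
Proof. by apply/colP => i; rewrite !mxE intrD. Qed.

Lemma intv0 d (R : realType) : intv R (0 : 'cV[int]_d) = 0.
Proof. by apply/colP => i; rewrite !mxE. Qed.

Lemma intvB d (k l : 'cV[int]_d) (R : realType) : intv R (k - l) = intv R k - intv R l.
Proof. by apply/colP => i; rewrite !mxE intrB. Qed.

Lemma mulmx_mxvec (R : comRingType) m n (A B : 'M[R]_(m, n)) :
  (mxvec A *m (mxvec B)^T) 0 0 = \sum_i \sum_j A i j * B i j.
Proof.
rewrite mxE (reindex _ (curry_mxvec_bij _ _)) /= pair_bigA /=.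
by apply: eq_bigr => [[i j]] /= _; rewrite mxE !mxvecE.
Qed.

Section Framework.
Variables (R : realType) (d : nat) (C : crystal R d).
Local Notation Z := (period C).

Lemma velocityP (a : R) (x y : vdata C) b :
  velocity (a *: x + y) b = a *: velocity x b + velocity y b.
Proof.
rewrite /velocity /= linearP /= !mulmxDl -!scalemxAl scalerBr.
by rewrite opprD addrACA.
Qed.

Lemma rigidity_is_linear : linear (@rigidity R d C).
Proof.
move=> a x y; rewrite /rigidity.
have -> : coords (a *: x + y).1 ((a *: x + y).2 *m Z) =
  a *: coords x.1 (x.2 *m Z) + coords y.1 (y.2 *m Z).
  rewrite /coords /= mulmxDl -scalemxAl !linearP /=.
  by rewrite scale_row_mx add_row_mx.
by rewrite linearP /= mulmxDr -scalemxAr.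
Qed.

HB.instance Definition _ := GRing.isLinear.Build R (vdata C) 'cV[R]_(nedge C) _
  (@rigidity R d C) rigidity_is_linear.

(** The rigidity row of a motif edge tests the relative velocity of the two
    ends of that edge in its direction: in [velocity x], the terms
    [- x.2 *m Z *m l] of the two ends differ by [x.2 *m Z] applied to the
    exponent.  All geometry of the rigidity map enters through this formula. *)
Lemma rigidityE (x : vdata C) e :
  rigidity x e 0 =
  mxdot (evec e) (velocity x (ends e).1 - velocity x (ends e).2).
Proof.
have -> : rigidity x e 0 = (row e (rigidity_mx C) *m (coords x.1 (x.2 *m Z))^T) 0 0.
  by rewrite -row_mul [RHS]mxE.
rewrite /rigidity_mx rowK; move: (evec e) => w.
rewrite /coords tr_row_mx mul_row_col mxE !mulmx_mxvec.
rewrite exchange_big /= [X in _ + X]exchange_big /= -big_split /=.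
rewrite /mxdot; apply: eq_bigr => i _; rewrite big_ord1.
set a := (ends e).1; set b := (ends e).2; set v := w i 0.
have -> : (velocity x a - velocity x b) i 0 =
    x.1 i a.1 - x.1 i b.1 + (x.2 *m Z *m intv R (b.2 - a.2)) i 0.
  by rewrite /velocity intvB mulmxBr !mxE; lra.
have pick (c : 'I_(nvert C)) : \sum_j (j == c)%:R * x.1 i j = x.1 i c.
  rewrite (bigD1 c) //= eqxx mul1r big1 ?addr0 // => j /negPf ->.
  by rewrite mul0r.
rewrite mulrDr -(pick a.1) -(pick b.1) -sumrB mulr_sumr [X in _ + v * X]mxE mulr_sumr.
congr (_ + _); apply: eq_bigr => j _; rewrite !mxE -/a -/b -/v; first by ring.
by ring.
Qed.

(** The values on the motif give the first component, and the change along the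
    [j]-th period gives the [j]-th column of [x.2 *m Z]. *)
Lemma velocity_inj : injective (@velocity R d C).
Proof.
move=> x y xy.
have xyE c i : velocity x c i 0 = velocity y c i 0 by rewrite xy.
have k0 := Ordinal (nvert_gt0 C).
have E1 : x.1 = y.1.
  apply/matrixP => i k; have := xyE (k, 0) i.
  by rewrite /velocity /= intv0 !mulmx0 !subr0 !mxE.
have E2 : x.2 *m Z = y.2 *m Z.
  apply/matrixP => i j; have := xyE (k0, delta_mx j 0) i; rewrite /velocity /=.
  have -> : intv R (delta_mx j 0 : 'cV[int]_d) = delta_mx j 0.
    by apply/colP => k; rewrite !mxE; case: (_ && _).
  by rewrite E1 -!colE !mxE => /addrI/oppr_inj.
case: x y {xy xyE} E1 E2 => [u A] [v B] /= -> /(can_inj (mulmxK (period_unit C))) ->.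
by [].
Qed.

Lemma vdata_dot_inner : inner_product (@vdata_dot R d C).
Proof.
exact: (pair_dot_inner (mxdot_inner R d (nvert C)) (mxdot_inner R d d)).
Qed.

Lemma H_v_subspace E : subspace (@H_v R d C E).
Proof.
split=> [|a x y Ex Ey]; first by rewrite /H_v /= mem0v.
by rewrite /H_v /= memvD ?memvZ.
Qed.

Lemma H_rig_subspace E : subspace (@H_rig R d C E).
Proof.
have [E0 Elin] := H_v_subspace E.
split=> [|a x y [Ex [S [b [Sa xE]]]] [Ey [S' [b' [Sa' yE]]]]]; split=> //.
- exists 0, 0; split=> [|c]; first by rewrite trmx0 oppr0.
  by rewrite /velocity /= col0 !mul0mx subr0 addr0.
- exact: Elin.
exists (a *: S + S'), (a *: b + b'); split=> [|c].
  by rewrite linearP /= Sa Sa' scalerN opprD.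
by rewrite velocityP xE yE mulmxDl -scalemxAl scalerDr addrACA.
Qed.

(** A rigid motion field [S p + b] with [S] skew gives an edge vector [v] the
    relative velocity [S v], which is orthogonal to [v]. *)
Lemma H_rig_flex E x : @H_rig R d C E x -> H_v E x /\ rigidity x = 0.
Proof.
case=> Ex [S [b [Sa xE]]]; split=> //; apply/colP => e.
rewrite rigidityE !xE opprD addrACA subrr addr0 -mulmxBr mxE.
have [_ dC _] := mxdot_inner R d 1.
have := mxdot_adj S (evec e) (evec e).
rewrite Sa mulNmx -scaleN1r mxdotZr dC /evec; lra.
Qed.

End Framework.

(** * The action of a symmetry on velocity data and edges *)

Section SymmetryAction.
Variables (R : realType) (d : nat) (C : crystal R d).
Variable g : 'cV[R]_d -> 'cV[R]_d.
Hypothesis gC : space_group C g.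
Hypothesis gsep : semiseparable C (ginv g).
Local Notation Z := (period C).
Local Notation L := (lin_part g).
Local Notation sigma := (@vact R d C (ginv g)).
Local Notation eta := (@eact R d C (ginv g)).

Let giso : Defs.isometry g. Proof. by case: gC. Qed.

Lemma fpoint_vact a : fpoint (sigma a) = ginv g (fpoint a).
Proof.
have [_ gv _] := gC.
have : range (@fpoint R d C) (fpoint a) by exists a.
rewrite -gv => -[_ [b _ <-] gb].
apply: (xgetPex a (P := [set b | fpoint b = ginv g (fpoint a)])).
by exists b; rewrite /= -gb (ginvK giso).
Qed.

Lemma fedge_eact b : fedge (eta b) = ginv g @` fedge b.
Proof.
have [_ _ ge] := gC.
have : range (@fedge R d C) (fedge b) by exists b.
rewrite -ge => -[_ [c _ <-] gc].
apply: (xgetPex b (P := [set c | fedge c = ginv g @` fedge b])).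
exists c; rewrite /= -gc image_comp.
rewrite -[LHS]image_id; apply: eq_imagel => x _.
by rewrite /= (ginvK giso).
Qed.

Lemma vact_class k l : (sigma (k, l)).1 = (sigma (k, 0)).1.
Proof. by have [s sE] := gsep; rewrite !sE. Qed.

(** Semiseparability makes [g^-1] send the whole class of a motif vertex into one
    class; comparing images of two points of a class shows how [g^-1] acts on
    the lattice of periods. *)
Lemma vact_translate k l :
  Z *m intv R (sigma (k, l)).2 =
  Z *m intv R (sigma (k, 0)).2 + L^T *m (Z *m intv R l).
Proof.
have := fpoint_vact (k, l); have := fpoint_vact (k, 0).
rewrite !(ginvE giso) /fpoint /transl /= intv0 mulmx0 addr0 (vact_class k l).
move=> E0 El.
have /(canRL (addrK _)) -> : Z *m intv R (sigma (k, l)).2 + motif (sigma (k, 0)).1 =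
   motif (sigma (k, 0)).1 + Z *m intv R (sigma (k, 0)).2 + L^T *m (Z *m intv R l).
  by rewrite addrC El E0 -mulmxDr [in RHS]addrAC.
by rewrite -addrA [motif _ + _]addrC addrA [X in X - _]addrAC addrK.
Qed.

Lemma lattice_pull_back l : exists m, L^T *m (Z *m intv R l) = Z *m intv R m.
Proof.
pose k := Ordinal (nvert_gt0 C).
exists ((sigma (k, l)).2 - (sigma (k, 0)).2).
by rewrite intvB mulmxBr vact_translate addrC addKr.
Qed.

Lemma fedge_transl e k l :
  fedge (c := C) (e, k + l) = transl Z l @` fedge (c := C) (e, k).
Proof.
rewrite /fedge /= image_setU !image_set1 /transl intvD mulmxDr.
by rewrite !addrA.
Qed.

(** Since [g^-1] normalizes the translation group, translates of an edge go to
    translates of its image.  Hence periodic edge vectors stay periodic. *)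
Lemma eact_class e k : (eta (e, k)).1 = (eta (e, 0)).1.
Proof.
have [m mE] := lattice_pull_back k.
suff -> : eta (e, k) = ((eta (e, 0)).1, (eta (e, 0)).2 + m) by [].
apply: fedge_inj; rewrite fedge_transl fedge_eact -[k]add0r fedge_transl.
rewrite -surjective_pairing fedge_eact !image_comp.
apply: eq_imagel => x _ /=.
by rewrite !(ginvE giso) /transl -mE -mulmxDr addrAC.
Qed.

(** By [eact_class] the edge with lattice index 0 stands for its whole class. *)
Definition pull_edges (w : 'cV[R]_(nedge C)) : 'cV[R]_(nedge C) :=
  \col_e w (eta (e, 0)).1 0.

Lemma pi_eE w : pi_e g w = pull_edges w.
Proof.
apply: xget_unique => [|z zE].
  by apply/funext => -[e k]; rewrite /periodic /rho_e mxE (eact_class e k).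
apply/colP => e; have := congr1 (fun u : elabel C -> R => u (e, 0)) zE.
by rewrite /periodic /rho_e mxE.
Qed.

(** The transformed velocities have affine part [x.2] again when [x.2] commutes
    with the linear part of [g], and their first component is read off on the
    motif, at lattice index 0.  This formula extends [pi_v], which is only
    meaningful on [H_v], to a linear map on all data. *)
Definition pull_vdata (x : vdata C) : vdata C :=
  (\matrix_(i, k) rho_v g (velocity x) (k, 0) i 0, x.2).

(** Moving [L] past [x.2] and cancelling [L *m L^T] turns the pulled back lattice
    vector [L^T *m (Z *m l)] into [Z *m l]. *)
Lemma velocity_pull x : L *m x.2 = x.2 *m L ->
  velocity (pull_vdata x) = rho_v g (velocity x).
Proof.
move=> comm; apply/funext => -[k l]; rewrite /velocity /rho_v /=.
have -> : col k (\matrix_(i, k) (L *m velocity x (sigma (k, 0))) i 0) =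
  L *m velocity x (sigma (k, 0)) by apply/colP => i; rewrite !mxE.
rewrite /velocity (vact_class k l) -!mulmxA vact_translate mulmxDr.
rewrite opprD addrA [in RHS]mulmxBr; congr (_ - _).
rewrite !mulmxA comm -(mulmxA x.2 L) (mulmx1C (lin_part_orthogonal giso)).
by rewrite mulmx1.
Qed.

Lemma pi_vE (E : {vspace 'M[R]_d}) x :
  x.2 \in E -> L *m x.2 = x.2 *m L -> pi_v E g x = pull_vdata x.
Proof.
move=> Ex comm; apply: xget_unique; first by split=> //; exact: velocity_pull.
by move=> y [_ yE]; apply: velocity_inj; rewrite yE velocity_pull.
Qed.

Lemma pull_vdata_is_linear : linear pull_vdata.
Proof.
move=> a x y; congr (_, _); apply/matrixP => i k.
by rewrite mxE /rho_v velocityP mulmxDr -scalemxAr !mxE.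
Qed.

HB.instance Definition _ := GRing.isLinear.Build R (vdata C) (vdata C) _
  pull_vdata pull_vdata_is_linear.

Lemma pull_edges_is_linear : linear pull_edges.
Proof. by move=> a x y; apply/colP => e; rewrite !mxE. Qed.

HB.instance Definition _ := GRing.isLinear.Build R 'cV[R]_(nedge C)
  'cV[R]_(nedge C) _ pull_edges pull_edges_is_linear.

(** Edges are unordered, so [g^-1] may exchange the two ends of an edge with
    respect to the chosen orientation of its class. *)
Lemma edge_pull_back e (f := (eta (e, 0)).1) (k := (eta (e, 0)).2)
    (a := ((ends f).1.1, (ends f).1.2 + k)) (b := ((ends f).2.1, (ends f).2.2 + k)) :
  (sigma (ends e).1 = a /\ sigma (ends e).2 = b) \/
  (sigma (ends e).1 = b /\ sigma (ends e).2 = a).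
Proof.
have fpD (c : vlabel C) l : transl Z l (fpoint c) = fpoint (c.1, c.2 + l).
  by rewrite /fpoint /transl intvD mulmxDr addrA.
have := fedge_eact (e, 0).
rewrite [in RHS]/fedge /= image_setU !image_set1 {1}/transl intv0 mulmx0 addr0.
rewrite {1}/transl intv0 mulmx0 addr0 -!fpoint_vact /fedge !fpD -/f -/k -/a -/b.
move=> ab.
have mem c :
    fpoint c = fpoint (sigma (ends e).1) \/
      fpoint c = fpoint (sigma (ends e).2) ->
    c = a \/ c = b.
  move=> cE; have : [set fpoint a; fpoint b] (fpoint c) by rewrite ab.
  by case=> /fpoint_inj; [left|right].
have ne : sigma (ends e).1 <> sigma (ends e).2.
  move=> /(congr1 (@fpoint R d C)); rewrite !fpoint_vact => /(ginv_inj giso).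
  exact: ends_neq.
have [E1|E1] := mem _ (or_introl erefl); have [E2|E2] := mem _ (or_intror erefl).
- by case: ne; rewrite E1 E2.
- by left.
- by right.
- by case: ne; rewrite E1 E2.
Qed.

(** Testing the rotated relative velocity against [v_e] amounts to testing the
    original one against [L^T v_e], which, [L] being orthogonal, is the edge
    vector of the pulled back edge; a reversal of that edge changes both
    signs. *)
Lemma rigidity_pull (x : vdata C) : L *m x.2 = x.2 *m L ->
  rigidity (pull_vdata x) = pull_edges (rigidity x).
Proof.
move=> comm; apply/colP => e; rewrite [RHS]mxE !rigidityE velocity_pull //.
have [_ dC _] := mxdot_inner R d 1.
rewrite /rho_v -mulmxBr dC mxdot_adj.
rewrite -(ginvB giso) -!fpoint_vact.
set f := (eta (e, 0)).1.
have shp (c c' : vlabel C) l :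
    fpoint (c.1, c.2 + l) - fpoint (c'.1, c'.2 + l) = fpoint c - fpoint c'.
  by rewrite /fpoint /transl !intvD !mulmxDr !addrA opprD addrACA subrr addr0.
have shv (c c' : vlabel C) l :
    velocity x (c.1, c.2 + l) - velocity x (c'.1, c'.2 + l) =
    velocity x c - velocity x c'.
  have sh c0 : velocity x (c0.1, c0.2 + l) = velocity x c0 - x.2 *m Z *m intv R l.
    by rewrite /velocity /= intvD mulmxDr opprD addrA.
  by rewrite !sh opprB addrA subrK.
case: (edge_pull_back e) => -[-> ->]; rewrite shp shv dC //.
by rewrite -mxdotNN !opprB.
Qed.

End SymmetryAction.

Theorem corollary3p3 (R : realType) (d : nat) (C : crystal R d)
    (g : 'cV[R]_d -> 'cV[R]_d) (hg : space_group C g)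
    (hsep : forall h, cyclic_group g h -> semiseparable C h)
    (hg' : semiseparable C g \/ acts_on_motif C g)
    (E : {vspace 'M[R]_d})
    (hE : forall A : 'M[R]_d, A \in E -> lin_part g *m A = A *m lin_part g) :
  tr_mech C E g - tr_str C E g = tr_v C E g - tr_e C g - tr_rig C E g.
Proof.
have gsep : semiseparable C (ginv g) by apply: hsep; exists 1%N; right.
apply: (trace_euler_formula (vdata_dot_inner C) (mxdot_inner R _ 1)
  (r := @rigidity R d C) (f := @pull_vdata R d C g) (h := @pull_edges R d C g)).
- exact: H_v_subspace.
- exact: H_rig_subspace.
- exact: H_rig_flex.
- by [].
- by move=> x Ex; apply: rigidity_pull => //; apply: hE.
- by move=> x Ex; apply: pi_vE => //; apply: hE.
- exact: pi_eE.
Qed.
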